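(* Let $G$ be an additive group, let $X$ be a complete non-Archimedean normed space over a field $K$ with a non-trivial non-Archimedean valuation $|\cdot|$, and let $k$ be a fixed integer with $k\neq 0,\pm1$. For $f:G\to X$ put $$Df(x,y)=f(x+ky)+f(x-ky)-k^2f(x+y)-k^2f(x-y)-2(1-k^2)f(x).$$ Let $\varphi:G\times G\to[0,\infty)$, and for $u\in G$ write $$\Phi(u)=\max\{|2(k^2-1)|\varphi(u,u),\ |k^2|\varphi(2u,u),\ \varphi(u,2u),\ \varphi((k+1)u,u),\ \varphi((k-1)u,u),\ \varphi(u,u),\ |k^2|\varphi(2u,2u),\ |2(k^2-1)|\varphi(u,2u),\ \varphi(u,3u),\ \varphi((2k+1)u,u),\ \varphi((2k-1)u,u)\}.$$ Suppose that $$\lim_{n\to\infty}\frac{1}{|2^n|}\max\{\varphi(2^{n+1}x,2^{n+1}y),|8|\varphi(2^nx,2^ny)\}=\lim_{n\to\infty}\frac{1}{|8^n|}\max\{\varphi(2^{n+1}x,2^{n+1}y),|2|\varphi(2^nx,2^ny)\}=0$$ for all $x,y\in G$, and that for each $x\in G$ the limits $$\tilde{\varphi}_A(x):=\lim_{n\to\infty}\max\Big\{\frac{1}{|2^i|}\Phi(2^{i-1}x):0\le i<n\Big\},\qquad \tilde{\varphi}_C(x):=\lim_{n\to\infty}\max\Big\{\frac{1}{|8^i|}\Phi(2^{i-1}x):0\le i<n\Big\}$$ exist. Suppose that $f:G\to X$ is an odd function satisfying $\|Df(x,y)\|\le\varphi(x,y)$ for all $x,y\in G$. Then there exist an additive function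 $A:G\to X$ and a cubic function $C:G\to X$ such that $$\|f(x)-A(x)-C(x)\|\le\frac{1}{|k^2(k^2-1)|}\max\Big\{\frac{1}{|2|}\tilde{\varphi}_A(x),\ \frac{1}{|8|}\tilde{\varphi}_C(x)\Big\}\qquad(x\in G).$$ Moreover, if $$\lim_{i\to\infty}\lim_{n\to\infty}\max\Big\{\frac{1}{|2^j|}\Phi(2^{j-1}x):i\le j<n+i\Big\}=0\quad\text{and}\quad\lim_{i\to\infty}\lim_{n\to\infty}\max\Big\{\frac{1}{|8^j|}\Phi(2^{j-1}x):i\le j<n+i\Big\}=0,$$ then $A$ is the unique additive function and $C$ is the unique cubic function satisfying this inequality.
   Context: A non-Archimedean norm satisfies $\|x\|=0\iff x=0$, $\|rx\|=|r|\|x\|$ and $\|x+y\|\le\max\{\|x\|,\|y\|\}$. The proof combines the additive approximation $A_1$ of $f(2x)-8f(x)$ and cubic approximation $C_1$ of $f(2x)-2f(x)$ (obtained under the analogous hypotheses) and sets $A=-\tfrac16A_1$, $C=\tfrac16C_1$.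
   Formalization: The maxima defining the two limits run over 1≤i<n (and i≥1 in the uniqueness conditions), since the i=0 term Φ(2^{-1}x) is undefined in a general group; and k²(k²−1) is assumed nonzero in K, so that the bound is defined. *)

(* Defs.v *)
From HB Require Import structures.
From mathcomp Require Import all_boot all_order all_algebra.
From mathcomp Require Import all_classical all_reals all_analysis.
Set Implicit Arguments.
Unset Strict Implicit.
Unset Printing Implicit Defensive.
Import Order.TTheory GRing.Theory Num.Theory.
Local Open Scope ring_scope.

Definition nonarch_valuation (R : realType) (K : fieldType) (v : K -> R) : Prop :=
  [/\ forall a, 0 <= v a,
      forall a, v a = 0 <-> a = 0,
      forall a b, v (a * b) = v a * v b
    & forall a b, v (a + b) <= Num.max (v a) (v b)].

Definition nontrivial_valuation (R : realType) (K : fieldType) (v : K -> R) : Prop :=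
  exists a : K, v a != 0 /\ v a != 1.

Definition nonarch_norm (R : realType) (K : fieldType) (X : lmodType K)
    (v : K -> R) (nrm : X -> R) : Prop :=
  [/\ forall x, 0 <= nrm x,
      forall x, nrm x = 0 <-> x = 0,
      forall (r : K) x, nrm (r *: x) = v r * nrm x
    & forall x y, nrm (x + y) <= Num.max (nrm x) (nrm y)].

Definition complete_wrt (R : realType) (X : zmodType) (nrm : X -> R) : Prop :=
  forall u : nat -> X,
    (forall e : R, 0 < e -> exists N : nat, forall m n : nat,
        (N <= m)%N -> (N <= n)%N -> nrm (u m - u n) < e) ->
    exists l : X, forall e : R, 0 < e -> exists N : nat, forall n : nat,
        (N <= n)%N -> nrm (u n - l) < e.

Definition odd_fun (G X : zmodType) (f : G -> X) : Prop :=
  forall x, f (- x) = - f x.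

Definition additive_fun (G X : zmodType) (A : G -> X) : Prop :=
  forall x y, A (x + y) = A x + A y.

Definition cubic_fun (G X : zmodType) (C : G -> X) : Prop :=
  forall x y, C (x *+ 2 + y) + C (x *+ 2 - y)
              = C (x + y) *+ 2 + C (x - y) *+ 2 + C x *+ 12.

Definition Dop (G X : zmodType) (k : int) (f : G -> X) (x y : G) : X :=
  f (x + y *~ k) + f (x - y *~ k) - f (x + y) *~ (k ^+ 2) - f (x - y) *~ (k ^+ 2)
  - f x *~ (2 * (1 - k ^+ 2)).

Definition Phi (R : realType) (K : fieldType) (G : zmodType) (v : K -> R)
    (k : int) (phi : G -> G -> R) (u : G) : R :=
  let c1 := v (2 * (k ^+ 2 - 1))%:~R in
  let c2 := v (k ^+ 2)%:~R in
  Num.max (c1 * phi u u)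
  (Num.max (c2 * phi (u *+ 2) u)
  (Num.max (phi u (u *+ 2))
  (Num.max (phi (u *~ (k + 1)) u)
  (Num.max (phi (u *~ (k - 1)) u)
  (Num.max (phi u u)
  (Num.max (c2 * phi (u *+ 2) (u *+ 2))
  (Num.max (c1 * phi u (u *+ 2))
  (Num.max (phi u (u *+ 3))
  (Num.max (phi (u *~ (2 * k + 1)) u)
           (phi (u *~ (2 * k - 1)) u)))))))))).

(* max{ Phi(2^(i-1) x) / |b^i| : lo <= i < hi }  (b = 2 or 8);
   only used with lo >= 1, so 2^(i-1) is an honest power of 2. *)
Definition maxPhi (R : realType) (K : fieldType) (G : zmodType) (v : K -> R)
    (k : int) (phi : G -> G -> R) (b : nat) (x : G) (lo hi : nat) : R :=
  \big[Num.max/0]_(lo <= i < hi)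
     (Phi v k phi (x *+ (2 ^ i.-1)%N) / v ((b ^ i)%N)%:R).

(* Main.v *)
Require Import Defs.
From HB Require Import structures.
From mathcomp Require Import all_boot all_order all_algebra.
From mathcomp Require Import all_classical all_reals all_analysis.
From mathcomp Require Import ring lra.
Set Implicit Arguments.
Unset Strict Implicit.
Unset Printing Implicit Defensive.
Import Order.TTheory GRing.Theory Num.Theory.
Import numFieldNormedType.Exports.
Local Open Scope classical_set_scope.
Local Open Scope ring_scope.

(* Put [c = k^2 (k^2 - 1)] and [E u = f(4u) - 10 f(2u) + 16 f(u)].  Eliminating among
   values of [D f] shows that [c E u] is an integer combination of the terms measured by
   [Phi u], so [|E u| <= Phi u / |c|].  As [g x = f(2x) - 8 f(x)] and
   [h x = f(2x) - 2 f(x)] satisfy [g(2x) - 2 g(x) = h(2x) - 8 h(x) = E x], the limits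
   [A1] of [g(2^n x) / 2^n] and [C1] of [h(2^n x) / 8^n] exist and solve [D = 0].
   Every solution of [D = 0] has vanishing fourth differences; being odd, it is additive
   when it is 2-homogeneous under doubling and cubic when it is 8-homogeneous.

   Bounding [f - A - C = (h - C1)/6 - (g - A1)/6] by its two halves would lose a factor
   [1/|3|].  Combined, the two series have coefficients [(4^n - 1) / (6 * 8^n)], and 3
   divides [4^n - 1]; this gives the stated constant in residue characteristic 3 too.

   For uniqueness, let [a] and [b] be the differences of two additive and two cubic parts.
   The bound at [2^n x] gives [|2^n a + 8^n b| <= M |8|^n e_n] with [e_n -> 0]; comparing
   two consecutive [n] isolates [6 * 8^n b], hence [b = 0] and then [a = 0]. *)

(** * Integer-linear identities in abelian groups *)

(* The square-zero extension [int * V], with product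
   [(a, x) (b, y) = (a b, a y + b x)], is a commutative ring containing [V]: the [ring]
   tactic there decides linear identities with integer coefficients in [V]. *)
Definition sqzero_ext (V : zmodType) : Type := (int * V)%type.

Section SqzeroExt.
Variable V : zmodType.
Implicit Types p q r : sqzero_ext V.

HB.instance Definition _ := GRing.Zmodule.on (sqzero_ext V).

Definition sqzero_one : sqzero_ext V := (1, 0).
Definition sqzero_mul p q : sqzero_ext V := (p.1 * q.1, q.2 *~ p.1 + p.2 *~ q.1).

Fact sqzero_mulA : associative sqzero_mul.
Proof.
move=> [a x] [b y] [c z]; rewrite /sqzero_mul /= mulrA !mulrzDl -!mulrzA addrA.
by rewrite [c * a]mulrC [b * a]mulrC.
Qed.

Fact sqzero_mulC : commutative sqzero_mul.
Proof. by move=> [a x] [b y]; rewrite /sqzero_mul /= mulrC addrC. Qed.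

Fact sqzero_mul1 : left_id sqzero_one sqzero_mul.
Proof. by move=> [a x]; rewrite /sqzero_mul /= mul1r mulr1z mul0rz addr0. Qed.

Fact sqzero_mulDl : left_distributive sqzero_mul +%R.
Proof.
move=> [a x] [b y] [c z]; rewrite /sqzero_mul /= mulrDl mulrzDr mulrzDl.
by congr (_, _); rewrite addrACA.
Qed.

Fact sqzero_one_neq0 : sqzero_one != 0.
Proof. by []. Qed.

HB.instance Definition _ := GRing.Zmodule_isComNzRing.Build (sqzero_ext V)
  sqzero_mulA sqzero_mulC sqzero_mul1 sqzero_mulDl sqzero_one_neq0.

Definition sqzero_in (x : V) : sqzero_ext V := (0, x).

Fact sqzero_in_additive : zmod_morphism sqzero_in.
Proof. by move=> x y; congr (_, _). Qed.

HB.instance Definition _ :=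
  GRing.isZmodMorphism.Build V (sqzero_ext V) sqzero_in sqzero_in_additive.

Lemma sqzero_in_inj : injective sqzero_in.
Proof. by move=> x y []. Qed.

End SqzeroExt.

Ltac zmod := apply: sqzero_in_inj; ring.

(** * Divisibility by 6 and cancellation of integers *)

Lemma dvdz6_sqr_mul_sqrB1 (k : int) : exists m : int, k ^+ 2 * (k ^+ 2 - 1) = 6 * m.
Proof.
have r0 := modz_ge0 k (isT : (6 : int) != 0).
have r6 := @ltz_pmod k 6 isT.
rewrite (divz_eq k 6); set q := (k %/ 6)%Z.
move: (k %% 6)%Z r0 r6 => [] // r _; do 6?[case: r => [_|r]] => //.
(* For [k = 6 q + r] put [s = 6 q^2 + 2 r q], so that [k^2 = 6 s + r^2]; the witness is [6 s^2 + (2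
   r^2 - 1) s + r^2 (r^2 - 1) / 6]. *)
- by exists (q ^+ 2 * 6 * (36 * q ^+ 2 - 1)); ring.
- by exists ((6 * q ^+ 2 + 2 * q) * (6 * (6 * q ^+ 2 + 2 * q) + 1)); ring.
- set s := 6 * q ^+ 2 + 4 * q; exists (6 * s ^+ 2 + 7 * s + 2); rewrite /s; ring.
- set s := 6 * q ^+ 2 + 6 * q; exists (6 * s ^+ 2 + 17 * s + 12); rewrite /s; ring.
- set s := 6 * q ^+ 2 + 8 * q; exists (6 * s ^+ 2 + 31 * s + 40); rewrite /s; ring.
- set s := 6 * q ^+ 2 + 10 * q; exists (6 * s ^+ 2 + 49 * s + 100); rewrite /s; ring.
Qed.

(** This excludes characteristics 2 and 3, which justifies every later division by 2, 3, 6 or 8. *)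
Lemma natr6_neq0 (K : fieldType) (k : int) :
  (k ^+ 2 * (k ^+ 2 - 1))%:~R != 0 :> K -> 6%:R != 0 :> K.
Proof.
have [m ->] := dvdz6_sqr_mul_sqrB1 k.
by rewrite intrM mulf_eq0 negb_or => /andP[].
Qed.

Lemma mulrz_inj0 (K : fieldType) (X : lmodType K) (x : X) (n : int) :
  n%:~R != 0 :> K -> x *~ n = 0 -> x = 0.
Proof. by move=> n0 /eqP; rewrite -scaler_int scaler_eq0 (negbTE n0) => /eqP. Qed.

(** * Finite differences and the exact solutions of [D f = 0] *)

Definition fdiff (G X : zmodType) (h : G) (f : G -> X) (x : G) : X :=
  f (x + h) - f x.

(* Moving [x] by [- a h] and [y] by [h] fixes [x + a y], so differencing along
   this direction removes the term [f0]. *)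
Lemma fdiff_elim (G X : zmodType) (a : int) (f0 : G -> X) (s : seq (int * (G -> X))) :
  (forall x y, \sum_(p <- (a, f0) :: s) p.2 (x + y *~ p.1) = 0) ->
  forall h x y,
  \sum_(p <- [seq (p.1, fdiff (h *~ (p.1 - a)) p.2) | p <- s]) p.2 (x + y *~ p.1) = 0.
Proof.
move=> H h x y; rewrite big_map /=.
have H1 := H (x - h *~ a) (y + h); have H0 := H x y.
have e : x - h *~ a + (y + h) *~ a = x + y *~ a by zmod.
rewrite !big_cons /= ?e in H0 H1.
rewrite /fdiff sumrB; apply/eqP; rewrite subr_eq0; apply/eqP.
apply: (addrI (f0 (x + y *~ a))); rewrite H0 -[RHS]H1; congr (_ + _).
by apply: eq_bigr => p _; congr (p.2 _); zmod.
Qed.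

Section DopSolutions.
Variables (K : fieldType) (G : zmodType) (X : lmodType K) (k : int).
Hypothesis c_neq0 : (k ^+ 2 * (k ^+ 2 - 1))%:~R != 0 :> K.

Let n6 : 6%:R != 0 :> K. Proof. exact: natr6_neq0 c_neq0. Qed.

Let n2 : (2 : int)%:~R != 0 :> K.
Proof. by apply: contraNneq n6 => e; rewrite (natrM _ 2 3) (e : 2%:R = 0) mul0r. Qed.

Let n3 : (3 : int)%:~R != 0 :> K.
Proof. by apply: contraNneq n6 => e; rewrite (natrM _ 2 3) (e : 3%:R = 0) mulr0. Qed.

Lemma Dop_fdiff (f : G -> X) h x y :
  Dop k (fdiff h f) x y = Dop k f (x + h) y - Dop k f x y.
Proof.
rewrite /Dop /fdiff.
have -> : x + h + y *~ k = x + y *~ k + h by zmod.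
have -> : x + h - y *~ k = x - y *~ k + h by zmod.
have -> : x + h + y = x + y + h by zmod.
have -> : x + h - y = x - y + h by zmod.
zmod.
Qed.

(** The equation is a sum of terms of slopes [1], [-1], [k], [- k] and [0] in [y]. Eliminating the
    first four leaves a fourth difference of the slope-zero term. *)
Lemma Dop0_fdiff4k (f : G -> X) : (forall x y, Dop k f x y = 0) ->
  forall a b c d x,
  fdiff (c *~ k) (fdiff (d *~ k) (fdiff a (fdiff b f))) x = 0.
Proof.
move=> Df a b c d x.
pose s : seq (int * (G -> X)) := [:: (1, fun x => - (f x *~ (k ^+ 2)));
  (-1, fun x => - (f x *~ (k ^+ 2))); (k, f); (- k, f);
  (0, fun x => - (f x *~ (2 * (1 - k ^+ 2))))].
have H : forall x y, \sum_(p <- s) p.2 (x + y *~ p.1) = 0.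
  move=> {}x y; rewrite -[RHS](Df x y) /s !big_cons big_nil /Dop /=.
  have -> : x + y *~ 1 = x + y by zmod.
  have -> : x + y *~ (-1) = x - y by zmod.
  have -> : x + y *~ (- k) = x - y *~ k by zmod.
  have -> : x + y *~ 0 = x by zmod.
  zmod.
(* The increments are signed so that the slope-zero term is differenced along [b], [a], [d k] and
   [c k] in turn. *)
have /= {}H := fdiff_elim H (- b).
have /= {}H := fdiff_elim H a.
have /= {}H := fdiff_elim H (- d).
have /= {}H := fdiff_elim H c.
have := H x 0.
rewrite big_cons big_nil /= addr0 mul0rz addr0.
have -> : c *~ (0 - - k) = c *~ k by zmod.
have -> : (- d) *~ (0 - k) = d *~ k by zmod.
have -> : a *~ (0 - -1) = a by zmod.
have -> : (- b) *~ (0 - 1) = b by zmod.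
move=> H0; apply: (@mulrz_inj0 K _ _ (2 * (k ^+ 2 - 1))).
  rewrite intrM mulf_neq0 //; apply: contraNneq c_neq0 => e.
  by rewrite intrM e mulr0.
by rewrite -[RHS]H0 /fdiff; zmod.
Qed.

(** Jensen at [x + a] with step [b], plus at [x + b] with step [a], minus at [x] with step [a - b],
    leaves twice the second difference. *)
Lemma jensen_fdiff2 (F : G -> X) :
  (forall x y, F (x + y) + F (x - y) = F x *+ 2) ->
  forall a b x, fdiff a (fdiff b F) x = 0.
Proof.
move=> J a b x; apply: (@mulrz_inj0 K _ _ 2) => //; rewrite /fdiff.
have J1 := J (x + a) b; have J2 := J (x + b) a; have J3 := J x (a - b).
rewrite -[x + b + a]addrA [b + a]addrC addrA in J2.
have e1 : x + (a - b) = x + a - b by zmod.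
have e2 : x - (a - b) = x + b - a by zmod.
rewrite {}e1 {}e2 in J3.
transitivity (F (x + a + b) + F (x + a - b) - F (x + a) *+ 2
   + (F (x + a + b) + F (x + b - a) - F (x + b) *+ 2)
   - (F (x + a - b) + F (x + b - a) - F x *+ 2)); first by zmod.
by rewrite J1 J2 J3 !subrr addr0 subr0.
Qed.

(* The second difference [F] of [f] along [c] and [d] solves the same equation and is
   affine along [k G]; hence the equation collapses to Jensen's. *)
Lemma Dop0_fdiff4 (f : G -> X) : (forall x y, Dop k f x y = 0) ->
  forall a b c d x, fdiff a (fdiff b (fdiff c (fdiff d f))) x = 0.
Proof.
move=> Df a b c d x; set F := fdiff c _.
have DF y z : Dop k F y z = 0 by rewrite /F !(Dop_fdiff, Df) !subrr.
apply: jensen_fdiff2 => {}x y.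
(* This reads [F (x + k y) + F (x - k y) = 2 F x] and reduces [D F = 0] to [k^2] times Jensen's
   equation. *)
have kF := Dop0_fdiff4k Df c d y y (x - y *~ k).
rewrite -/F /fdiff !addrNK in kF.
have := DF x y; rewrite /Dop => DF0.
apply/eqP; rewrite -subr_eq0; apply/eqP.
apply: (@mulrz_inj0 K _ _ (k ^+ 2)).
  by apply: contraNneq c_neq0 => e; rewrite intrM e mul0r.
rewrite -[RHS](subrr 0) -[X in _ = X - _]kF -[X in _ = _ - X]DF0; zmod.
Qed.

Section Odd.
Variable f : G -> X.
Hypothesis (Df : forall x y, Dop k f x y = 0) (oddf : odd_fun f).

Lemma odd_fun0 : f 0 = 0.
Proof.
apply: (@mulrz_inj0 K _ _ 2) => //.
by rewrite -[RHS](subrr (f 0)) -oddf oppr0; zmod.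
Qed.

(** The fourth difference with steps [x, x, y, y] is based at [- y], so that its part free of [x],
    [f (- y) - 2 f 0 + f y], vanishes by oddness. *)
Lemma Dop0_dbl_left x y :
  f (x *+ 2 + y) + f (x *+ 2 - y) - f (x *+ 2) *+ 2 =
  (f (x + y) + f (x - y) - f x *+ 2) *+ 2.
Proof.
apply/eqP; rewrite -subr_eq0; apply/eqP.
rewrite -[RHS](Dop0_fdiff4 Df x x y y (- y)) /fdiff addNr add0r.
have -> : - y + x + x + y + y = x *+ 2 + y by zmod.
have -> : - y + x + x + y = x *+ 2 by zmod.
have -> : - y + x + x = x *+ 2 - y by zmod.
have -> : - y + x + y + y = x + y by zmod.
have -> : - y + x + y = x by zmod.
have -> : - y + x = x - y by zmod.
rewrite oddf odd_fun0; zmod.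
Qed.

Lemma Dop0_dbl_right x y :
  f (x + y *+ 2) + f (x - y *+ 2) - f x *+ 2 =
  (f (x + y) + f (x - y) - f x *+ 2) *+ 4.
Proof.
apply/eqP; rewrite -subr_eq0; apply/eqP.
rewrite -[RHS](Dop0_fdiff4 Df y y y y (x - y *+ 2)) /fdiff.
have -> : x - y *+ 2 + y + y + y + y = x + y *+ 2 by zmod.
have -> : x - y *+ 2 + y + y + y = x + y by zmod.
have -> : x - y *+ 2 + y + y = x by zmod.
have -> : x - y *+ 2 + y = x - y by zmod.
zmod.
Qed.

Lemma Dop0_cubic : (forall x, f (x *+ 2) = f x *+ 8) -> cubic_fun f.
Proof.
move=> f8 x y; have := Dop0_dbl_left x y; rewrite f8 => /(canRL (subrK _)) ->; zmod.
Qed.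

(* If [g x y] is the second difference at [x] with step [y], doubling [x] multiplies
   [g] by 2, doubling [y] by 4, and doubling both by 2; so [g = 0]. *)
Lemma Dop0_additive : (forall x, f (x *+ 2) = f x *+ 2) -> additive_fun f.
Proof.
move=> f2; have jensen x y : f (x + y) + f (x - y) = f x *+ 2.
  apply/eqP; rewrite -subr_eq0; apply/eqP.
  apply: (@mulrz_inj0 K _ _ 3) => //; apply: (@mulrz_inj0 K _ _ 2) => //.
  have := Dop0_dbl_left x (y *+ 2); rewrite (Dop0_dbl_right x).
  rewrite -mulrnDl -mulrnBl !f2 => e.
  rewrite -[RHS](subrr (f (x + y) *+ 2 + f (x - y) *+ 2 - f x *+ 2 *+ 2)) [X in _ = X - _]e.
  zmod.
move=> x y; have := jensen_fdiff2 jensen x y 0.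
rewrite /fdiff !add0r odd_fun0 => e; apply/eqP; rewrite -subr_eq0 -e; apply/eqP; zmod.
Qed.

End Odd.
End DopSolutions.

(** * The relation between [f (4 u)], [f (2 u)] and [f u] *)

(* Elimination among the values of [D f] at multiples of [u]; the first bracket is
   [- c (f(4u) - 2 f(3u) - 2 f(2u) + 6 f(u))] and the second one
   [- c (f(3u) - 4 f(2u) + 5 f(u))], where [c = k^2 (k^2 - 1)]. *)
Lemma Dop_quadrupling (G X : zmodType) (k : int) (f : G -> X) (u : G) :
  odd_fun f -> f 0 = 0 ->
  (f (u *+ 4) - f (u *+ 2) *+ 10 + f u *+ 16) *~ (k ^+ 2 * (k ^+ 2 - 1)) =
  - (Dop k f (u *~ (2 * k + 1)) u - Dop k f (u *~ (2 * k - 1)) u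
     - Dop k f u (u *+ 3) - Dop k f u u + Dop k f (u *+ 2) (u *+ 2) *~ (k ^+ 2)
     - Dop k f u (u *+ 2) *~ (2 * (k ^+ 2 - 1)))
  - (Dop k f (u *~ (k + 1)) u - Dop k f (u *~ (k - 1)) u
     - Dop k f u (u *+ 2) + Dop k f (u *+ 2) u *~ (k ^+ 2)
     - Dop k f u u *~ (2 * (k ^+ 2 - 1))) *+ 2.
Proof.
move=> oddf f0.
(* All arguments are integer multiples of [u]; indexed by the multiplier, the claim is linear in the
   values of [F]. *)
pose F (n : int) := f (u *~ n).
have DE x y a b p q r s : x = u *~ a -> y = u *~ b ->
    a + b * k = p -> a - b * k = q -> a + b = r -> a - b = s ->
    Dop k f x y = F p + F q - F r *~ (k ^+ 2) - F s *~ (k ^+ 2)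
                  - F a *~ (2 * (1 - k ^+ 2)).
  move=> -> -> <- <- <- <-; rewrite /Dop /F.
  have -> : u *~ a + u *~ b *~ k = u *~ (a + b * k) by zmod.
  have -> : u *~ a - u *~ b *~ k = u *~ (a - b * k) by zmod.
  have -> : u *~ a + u *~ b = u *~ (a + b) by zmod.
  by have -> : u *~ a - u *~ b = u *~ (a - b) by zmod.
have FN n : F (- n) = - F n by rewrite /F mulrNz oddf.
have F0 : F 0 = 0 by rewrite /F mulr0z.
rewrite (DE _ _ (2 * k + 1) 1 (3 * k + 1) (k + 1) (2 * (k + 1)) (2 * k)); try by [|ring].
rewrite (DE _ _ (2 * k - 1) 1 (3 * k - 1) (k - 1) (2 * k) (2 * (k - 1))); try by [|ring].
(* Multipliers such as [1 - 3 k] are entered as opposites, so that oddness matches them with values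
   in the other equations. *)
rewrite (DE u (u *+ 3) 1 3 (3 * k + 1) (- (3 * k - 1)) 4 (- 2)); try by [|ring].
rewrite (DE u u 1 1 (k + 1) (- (k - 1)) 2 0); try by [|ring].
rewrite (DE (u *+ 2) (u *+ 2) 2 2 (2 * (k + 1)) (- (2 * (k - 1))) 4 0); try by [|ring].
rewrite (DE u (u *+ 2) 1 2 (2 * k + 1) (- (2 * k - 1)) 3 (- 1)); try by [|ring].
rewrite (DE _ u (k + 1) 1 (2 * k + 1) 1 (k + 2) k); try by [|ring].
rewrite (DE _ u (k - 1) 1 (2 * k - 1) (- 1) k (k - 2)); try by [|ring].
rewrite (DE (u *+ 2) u 2 1 (k + 2) (- (k - 2)) 3 1); try by [|ring].
rewrite !FN F0 -[f (u *+ 4)]/(F 4) -[f (u *+ 2)]/(F 2) -[f u]/(F 1); zmod.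
Qed.

(** * Sequences negligible relative to a weight *)

Definition negligible_wrt (R : realType) (w u : nat -> R) : Prop :=
  forall e, 0 < e -> exists N : nat, forall n, (N <= n)%N -> u n < e * w n.

Section NegligibleWrt.
Variables (R : realType).
Implicit Types w u t : nat -> R.

Lemma negligible_wrt_le w u t : (forall n, u n <= t n) ->
  negligible_wrt w t -> negligible_wrt w u.
Proof.
move=> ut t0 e e0; have [N H] := t0 e e0; exists N => n Nn.
exact: le_lt_trans (ut n) (H n Nn).
Qed.

Lemma negligible_wrt_max w u t :
  negligible_wrt w u -> negligible_wrt w t ->
  negligible_wrt w (fun n => Num.max (u n) (t n)).
Proof.
move=> u0 t0 e e0; have [N H] := u0 e e0; have [P I] := t0 e e0.
exists (maxn N P) => n; rewrite geq_max => /andP[Nn Pn].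
by rewrite gt_max H ?I.
Qed.

Lemma negligible_wrtZ w u a : 0 < a ->
  negligible_wrt w u -> negligible_wrt w (fun n => a * u n).
Proof.
move=> a0 u0 e e0; have [|N H] := u0 (a^-1 * e); first by rewrite mulr_gt0 ?invr_gt0.
by exists N => n /H; rewrite -mulrA ltr_pdivlMl.
Qed.

Lemma cvgn0_negligible_wrt w u : (forall n, 0 < w n) ->
  (fun n => (w n)^-1 * u n) @ \oo --> 0 -> negligible_wrt w u.
Proof.
move=> w0 /cvgrPdist_lt cu e e0; have [N _ H] := cu e e0.
exists N => n Nn; have := H n Nn; rewrite /= sub0r normrN => /(le_lt_trans (ler_norm _)).
by rewrite mulrC ltr_pdivrMr.
Qed.

End NegligibleWrt.

(** * Non-Archimedean valuations, norms and limits *)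

Definition nrm_cvg (R : realType) (X : zmodType) (nrm : X -> R) (u : nat -> X) (l : X) :=
  forall e : R, 0 < e -> exists N : nat, forall n : nat, (N <= n)%N -> nrm (u n - l) < e.

Section NonArch.
Variables (R : realType) (K : fieldType) (X : lmodType K).
Variables (v : K -> R) (nrm : X -> R).
Hypotheses (vP : nonarch_valuation v) (nrmP : nonarch_norm v nrm).

Lemma nav_ge0 a : 0 <= v a. Proof. by case: vP. Qed.

Lemma nav_gt0 a : a != 0 -> 0 < v a.
Proof.
case: vP => [v0 v0P _ _] a0; rewrite lt0r v0 andbT.
by apply: contra_neq a0 => /v0P.
Qed.

Lemma navM a b : v (a * b) = v a * v b. Proof. by case: vP. Qed.

Lemma nav1 : v 1 = 1.
Proof.
have v1 : v 1 != 0 by rewrite gt_eqF ?nav_gt0 ?oner_neq0.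
by apply: (mulfI v1); rewrite -navM !mulr1.
Qed.

Lemma navX a n : v (a ^+ n) = v a ^+ n.
Proof. by elim: n => [|n IHn]; rewrite ?expr0 ?nav1 // !exprS navM IHn. Qed.

Lemma navV a : a != 0 -> v a^-1 = (v a)^-1.
Proof.
move=> a0; have va : v a != 0 by rewrite gt_eqF ?nav_gt0.
by apply: (mulfI va); rewrite -navM !divff ?nav1.
Qed.

Lemma navN a : v (- a) = v a.
Proof.
rewrite -mulN1r navM -[RHS]mul1r; congr (_ * _); apply/eqP.
have : v (-1) ^+ 2 = 1 by rewrite -navX sqrrN expr1n nav1.
move/eqP; rewrite sqrf_eq1 => /orP[//|/eqP e].
by have := nav_ge0 (-1); rewrite e; lra.
Qed.

Lemma nav_nat_le1 n : v n%:R <= 1.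
Proof.
elim: n => [|n IHn]; first by case: vP => _ v0P _ _; rewrite (v0P _).2.
rewrite -natr1; case: vP => _ _ _ vD; apply: le_trans (vD _ _) _.
by rewrite ge_max IHn nav1 lexx.
Qed.

Lemma nav_int_le1 (n : int) : v n%:~R <= 1.
Proof. by case: n => n; rewrite ?NegzE ?mulrNz ?navN nav_nat_le1. Qed.

Lemma nrm_ge0 x : 0 <= nrm x. Proof. by case: nrmP. Qed.

Lemma nrmZ a x : nrm (a *: x) = v a * nrm x. Proof. by case: nrmP. Qed.

Lemma nrm0_eq0 x : nrm x = 0 -> x = 0. Proof. by case: nrmP => _ H _ _ /H. Qed.

Lemma nrm0 : nrm 0 = 0. Proof. by case: nrmP => _ H _ _; apply/H. Qed.

Lemma nrmN x : nrm (- x) = nrm x.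
Proof. by rewrite -scaleN1r nrmZ navN nav1 mul1r. Qed.

Lemma nrmD_le B x y : nrm x <= B -> nrm y <= B -> nrm (x + y) <= B.
Proof.
move=> xB yB; case: nrmP => _ _ _ nD; apply: le_trans (nD _ _) _.
by rewrite ge_max xB.
Qed.

Lemma nrmD_lt e x y : nrm x < e -> nrm y < e -> nrm (x + y) < e.
Proof.
move=> xB yB; case: nrmP => _ _ _ nD; apply: le_lt_trans (nD _ _) _.
by rewrite gt_max xB.
Qed.

Lemma nrmB_le B x y : nrm x <= B -> nrm y <= B -> nrm (x - y) <= B.
Proof. by move=> xB yB; apply: nrmD_le => //; rewrite nrmN. Qed.

Lemma nrmMz x (n : int) : nrm (x *~ n) = v n%:~R * nrm x.
Proof. by rewrite -scaler_int nrmZ. Qed.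

Lemma nrmMn x n : nrm (x *+ n) = v n%:R * nrm x.
Proof. by rewrite -scaler_nat nrmZ. Qed.

Lemma nrmMz_le x (n : int) : nrm (x *~ n) <= nrm x.
Proof. by rewrite nrmMz ler_piMl ?nrm_ge0 ?nav_int_le1. Qed.

Lemma nrmMn_le x n : nrm (x *+ n) <= nrm x.
Proof. exact: (nrmMz_le x n). Qed.

Lemma nrm_small_eq0 M x : (forall e, 0 < e -> nrm x <= M * e) -> x = 0.
Proof.
move=> H; apply: nrm0_eq0; apply/eqP; rewrite eq_le nrm_ge0 andbT.
apply/ler_addgt0Pr => e e0; rewrite add0r.
have M1 : 0 < `|M| + 1 by rewrite ltr_wpDl.
apply: le_trans (H (e / (`|M| + 1)) _) _; first by rewrite divr_gt0.
rewrite mulrA ler_pdivrMr // mulrC ler_pM2l //.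
by apply: le_trans (ler_norm _) _; rewrite lerDl.
Qed.

Lemma nrm_cvgD u t l m : nrm_cvg nrm u l -> nrm_cvg nrm t m ->
  nrm_cvg nrm (fun n => u n + t n) (l + m).
Proof.
move=> cu ct e e0; have [N H] := cu e e0; have [P I] := ct e e0.
exists (maxn N P) => n; rewrite geq_max => /andP[Nn Pn].
by rewrite opprD addrACA; apply: nrmD_lt; auto.
Qed.

Lemma nrm_cvgZ a u l : nrm_cvg nrm u l -> nrm_cvg nrm (fun n => a *: u n) (a *: l).
Proof.
move=> cu e e0; have [-> | a0] := eqVneq a 0.
  by exists 0%N => n _; rewrite !scale0r subrr nrm0.
have [N H] := cu (e / v a) (divr_gt0 e0 (nav_gt0 a0)).
exists N => n /H; rewrite ltr_pdivlMr ?nav_gt0 // => h.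
by rewrite -scalerBr nrmZ mulrC.
Qed.

Lemma nrm_cvgN u l : nrm_cvg nrm u l -> nrm_cvg nrm (fun n => - u n) (- l).
Proof. by move=> cu e /cu[N H]; exists N => n /H; rewrite -opprD nrmN. Qed.

Lemma nrm_cvgMz u l (c : int) :
  nrm_cvg nrm u l -> nrm_cvg nrm (fun n => u n *~ c) (l *~ c).
Proof.
move=> cu e /cu[N H]; exists N => n /H; apply: le_lt_trans.
by rewrite -mulrzBl nrmMz_le.
Qed.

Lemma nrm_cvg_const l : nrm_cvg nrm (fun=> l) l.
Proof. by move=> e e0; exists 0%N => n _; rewrite subrr nrm0. Qed.

Lemma nrm_cvg_eq u l m : nrm_cvg nrm u l -> nrm_cvg nrm u m -> l = m.
Proof.
move=> cu cm; apply/eqP; rewrite -subr_eq0; apply/eqP.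
apply: (@nrm_small_eq0 1) => e e0; rewrite mul1r ltW //.
have [N H] := cu e e0; have [P I] := cm e e0.
have -> : l - m = u (maxn N P) - m - (u (maxn N P) - l) by zmod.
by apply: nrmD_lt; rewrite ?nrmN; [apply: I|apply: H]; rewrite ?leq_maxl ?leq_maxr.
Qed.

Lemma nrm_cvg_shift u l : nrm_cvg nrm u l -> nrm_cvg nrm (fun n => u n.+1) l.
Proof. by move=> cu e /cu[N H]; exists N => n Nn; apply: H; apply: leqW. Qed.

Lemma eq_nrm_cvg u t l : u =1 t -> nrm_cvg nrm u l -> nrm_cvg nrm t l.
Proof. by move=> ut cu e /cu[N H]; exists N => n /H; rewrite ut. Qed.

Lemma nrm_cvg_le u l B : nrm_cvg nrm u l -> (forall n, nrm (u n) <= B) -> nrm l <= B.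
Proof.
move=> cu uB; apply/ler_addgt0Pr => e e0; have [N H] := cu e e0.
have B0 : 0 <= B := le_trans (nrm_ge0 _) (uB N).
have -> : l = u N - (u N - l) by zmod.
apply: nrmB_le; first by apply: le_trans (uB N) _; rewrite lerDl ltW.
by apply/ltW/(lt_le_trans (H N _)) => //; rewrite lerDr.
Qed.

Lemma nrm_cvg0 u : negligible_wrt (fun=> 1) (fun n => nrm (u n)) -> nrm_cvg nrm u 0.
Proof. by move=> u0 e /u0[N H]; exists N => n /H; rewrite subr0 mulr1. Qed.

(** A telescoping sum is bounded by its largest term, so consecutive differences tending to 0
    already make the sequence Cauchy. *)
Lemma nrm_cvg_telescope u : complete_wrt nrm ->
  negligible_wrt (fun=> 1) (fun n => nrm (u n.+1 - u n)) -> exists l, nrm_cvg nrm u l.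
Proof.
move=> cpl du; apply: cpl => e e0; have [N H] := du e e0.
have NH n : (N <= n)%N -> nrm (u n - u N) < e.
  elim: n => [|n IHn]; first by rewrite leqn0 => /eqP->; rewrite subrr nrm0.
  rewrite leq_eqVlt => /orP[/eqP<-|]; first by rewrite subrr nrm0.
  rewrite ltnS => Nn; rewrite -(subrKA (u n)).
  by apply: nrmD_lt; [rewrite -[e]mulr1; apply: H|apply: IHn].
exists N => m n Nm Nn; rewrite -(subrKA (u N)).
by apply: nrmD_lt; [exact: NH | rewrite -opprB nrmN NH].
Qed.

(** * Limits of [g (2^n x) / b^n] *)

Section ScaledLimit.
Variables (G : zmodType) (k : int) (b : nat) (g : G -> X).
Hypotheses (cpl : complete_wrt nrm) (b0 : b%:R != 0 :> K) (oddg : odd_fun g).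
Hypothesis step : forall x, negligible_wrt (fun n => v b%:R ^+ n.+1)
  (fun n => nrm (g (x *+ 2 ^ n *+ 2) - g (x *+ 2 ^ n) *+ b)).
Hypothesis Dg0 : forall x y, negligible_wrt (fun n => v b%:R ^+ n)
  (fun n => nrm (Dop k g (x *+ 2 ^ n) (y *+ 2 ^ n))).

(** Hyers' direct method: consecutive terms differ by the quantity in [step] over [b^(n+1)]; [Dop]
    passes to the limit termwise, and an index shift gives the doubling rule. *)
Lemma scaled_limit : exists L : G -> X,
  [/\ forall x, nrm_cvg nrm (fun n => (b%:R ^+ n)^-1 *: g (x *+ 2 ^ n)) (L x),
      odd_fun L, forall x y, Dop k L x y = 0 & forall x, L (x *+ 2) = L x *+ b].
Proof.
have bX n : (b%:R ^+ n != 0 :> K) by rewrite expf_neq0.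
have vbX n : 0 < v b%:R ^+ n by rewrite exprn_gt0 ?nav_gt0.
have /choice[L LP] x :
    exists l, nrm_cvg nrm (fun n => (b%:R ^+ n)^-1 *: g (x *+ 2 ^ n)) l.
  apply: nrm_cvg_telescope => // e /(step x)[N H]; exists N => n /H.
  have -> : (b%:R ^+ n.+1)^-1 *: g (x *+ 2 ^ n.+1) - (b%:R ^+ n)^-1 *: g (x *+ 2 ^ n)
      = (b%:R ^+ n.+1)^-1 *: (g (x *+ 2 ^ n *+ 2) - g (x *+ 2 ^ n) *+ b).
    rewrite scalerBr -[g _ *+ b]scaler_nat scalerA -mulrnA -expnSr.
    by congr (_ - _ *: _); rewrite exprSr invfM divfK.
  by move=> h; rewrite nrmZ navV // navX mulr1 mulrC ltr_pdivrMr.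
exists L; split => //.
- move=> x; apply: nrm_cvg_eq (LP (- x)) _.
  apply: eq_nrm_cvg (nrm_cvgN (LP x)) => n /=.
  by rewrite mulNrn oddg scalerN.
- move=> x y.
  have c1 : nrm_cvg nrm (fun n => (b%:R ^+ n)^-1 *: Dop k g (x *+ 2 ^ n) (y *+ 2 ^ n))
      (Dop k L x y).
    apply: eq_nrm_cvg (nrm_cvgD (nrm_cvgD (nrm_cvgD (nrm_cvgD (LP _) (LP _))
      (nrm_cvgN (nrm_cvgMz _ (LP _)))) (nrm_cvgN (nrm_cvgMz _ (LP _))))
      (nrm_cvgN (nrm_cvgMz _ (LP _)))) => n /=.
    have yk : y *~ k *+ 2 ^ n = y *+ 2 ^ n *~ k := mulrzAC (2 ^ n)%N k y.
    by rewrite /Dop !scalerBr !scalerDr -!scalerMzr !mulrnBl !mulrnDl yk.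
  apply: nrm_cvg_eq c1 _; apply: nrm_cvg0 => e /(Dg0 x y)[N H].
  exists N => n /H h.
  by rewrite nrmZ navV // navX mulr1 mulrC ltr_pdivrMr.
- move=> x; apply: nrm_cvg_eq (LP (x *+ 2)) _; rewrite -scaler_nat.
  apply: eq_nrm_cvg (nrm_cvgZ b%:R (nrm_cvg_shift (LP x))) => n /=.
  by rewrite scalerA exprS invfM mulrA divff // mul1r expnS mulrnA.
Qed.

End ScaledLimit.
End NonArch.

(** * Doubling identities *)

Lemma dvdn3_exp4B1 n : exists m, (4 ^ n = 1 + 3 * m)%N.
Proof.
elim: n => [|n [m e]]; first by exists 0%N.
by exists (1 + 4 * m)%N; rewrite expnS e; ring.
Qed.

Lemma additive_funMn (G X : zmodType) (A : G -> X) : additive_fun A ->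
  forall x n, A (x *+ 2 ^ n) = A x *+ 2 ^ n.
Proof.
move=> addA x; elim=> [|n IHn]; first by rewrite !mulr1n.
by rewrite expnSr !mulrnA mulr2n addA IHn -mulr2n.
Qed.

Lemma cubic_funMn (K : fieldType) (G : zmodType) (X : lmodType K) (C : G -> X) :
  2%:R != 0 :> K -> cubic_fun C -> forall x n, C (x *+ 2 ^ n) = C x *+ 8 ^ n.
Proof.
move=> n2 cubC x; elim=> [|n IHn]; first by rewrite !mulr1n.
rewrite !expnSr !mulrnA -IHn; set y := x *+ _.
(* With second argument 0 the cubic equation reads [2 C (2 y) = 16 C y]. *)
have := cubC y 0; rewrite !addr0 !subr0 => e.
apply/eqP; rewrite -subr_eq0; apply/eqP; apply: (@mulrz_inj0 K _ _ 2) => //.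
rewrite -[RHS](subrr (C (y *+ 2) + C (y *+ 2))) [X in _ = _ - X]e; zmod.
Qed.

(** The value [a = 8] gives [g], the source of [A1], and [a = 2] gives [h], the source of [C1]. *)
Definition dbl_diff (G X : zmodType) (a : nat) (f : G -> X) (x : G) : X :=
  f (x *+ 2) - f x *+ a.

(** With [T] for composition with doubling, this is the factorisation
    [T^2 - 10 T + 16 = (T - a) (T - b)]. *)
Lemma dbl_diff_step (G X : zmodType) (f : G -> X) a b x :
  (a + b = 10)%N -> (a * b = 16)%N ->
  dbl_diff a f (x *+ 2) - dbl_diff a f x *+ b =
  f (x *+ 4) - f (x *+ 2) *+ 10 + f x *+ 16.
Proof. by move=> <- <-; rewrite /dbl_diff -(mulrnA x 2 2); zmod. Qed.

Lemma odd_dbl_diff (G X : zmodType) (f : G -> X) a :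
  odd_fun f -> odd_fun (dbl_diff a f).
Proof. by move=> oddf x; rewrite /dbl_diff mulNrn !oddf; zmod. Qed.

Lemma Dop_dbl_diff (G X : zmodType) (k : int) (f : G -> X) a x y :
  Dop k (dbl_diff a f) x y = Dop k f (x *+ 2) (y *+ 2) - Dop k f x y *+ a.
Proof.
have yk : y *+ 2 *~ k = y *~ k *+ 2 := mulrzAC k 2 y.
by rewrite /Dop /dbl_diff yk -!mulrnDl -!mulrnBl; zmod.
Qed.

(** * Error estimates and uniqueness *)

Section Stability.
Variables (R : realType) (K : fieldType) (G : zmodType) (X : lmodType K).
Variables (v : K -> R) (nrm : X -> R) (k : int) (phi : G -> G -> R) (f : G -> X).
Hypotheses (vP : nonarch_valuation v) (nrmP : nonarch_norm v nrm).
Hypothesis c_neq0 : (k ^+ 2 * (k ^+ 2 - 1))%:~R != 0 :> K.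
Hypothesis phi_ge0 : forall x y, 0 <= phi x y.

Let c := v (k ^+ 2 * (k ^+ 2 - 1))%:~R.
Let P := Phi v k phi.

Let c_gt0 : 0 < c. Proof. exact: nav_gt0. Qed.

Let n6 : 6%:R != 0 :> K. Proof. exact: natr6_neq0 c_neq0. Qed.

Let n2 : 2%:R != 0 :> K.
Proof. by apply: contraNneq n6 => e; rewrite (natrM _ 2 3) e mul0r. Qed.

Let n8 : 8%:R != 0 :> K. Proof. by rewrite (natrX _ 2 3) expf_neq0. Qed.

Let v2_gt0 : 0 < v 2%:R. Proof. exact: nav_gt0. Qed.

Let v8_gt0 : 0 < v 8%:R. Proof. exact: nav_gt0. Qed.

Let v8_le_v2 : v 8%:R <= v 2%:R.
Proof. by rewrite (natrM _ 2 4) navM // ler_piMr ?nav_nat_le1 // ltW. Qed.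

Lemma Phi_ge0 u : 0 <= P u.
Proof. by rewrite /P /Phi !le_max phi_ge0 !orbT. Qed.

(** The eleven terms of [Dop_quadrupling] match the eleven entries of [Phi]; the outer factor 2 has
    valuation at most 1. *)
Lemma nrm_quadrupling u : odd_fun f ->
  (forall x y, nrm (Dop k f x y) <= phi x y) ->
  nrm (f (u *+ 4) - f (u *+ 2) *+ 10 + f u *+ 16) <= c^-1 * P u.
Proof.
move=> oddf fphi; rewrite ler_pdivlMl // -(nrmMz nrmP).
rewrite Dop_quadrupling ?(odd_fun0 c_neq0) //.
have [v0 _ _ _] := vP; move: (Dop k f) fphi => D fphi.
have le1 (x y : G) B : phi x y <= B -> nrm (D x y) <= B.
  exact: le_trans (fphi x y).
have le2 (x y : G) (m : int) B :
    v m%:~R * phi x y <= B -> nrm (D x y *~ m) <= B.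
  by apply: le_trans; rewrite (nrmMz nrmP) ler_wpM2l.
rewrite -opprD (nrmN vP nrmP).
by do !(apply: (nrmB_le vP nrmP) || apply: (nrmD_le nrmP)
  || apply: le1 || apply: le2 || apply: le_trans (nrmMn_le vP nrmP _ _) _);
  rewrite /P /Phi !le_max lexx ?orbT.
Qed.

(** Every entry of [Phi] is [phi] at fixed integer multiples of [2^n x], with a coefficient of
    valuation at most 1. *)
Lemma Phi_negligible (w : R) : 0 < w ->
  (forall x y, negligible_wrt (fun n => w ^+ n)
     (fun n => phi (x *+ (2 ^ n.+1)) (y *+ (2 ^ n.+1)))) ->
  forall x, negligible_wrt (fun n => w ^+ n.+1) (fun n => P (x *+ 2 ^ n)).
Proof.
move=> w0 H x.
have H1 (a b : int) : negligible_wrt (fun n => w ^+ n.+1)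
    (fun n => phi (x *+ 2 ^ n *~ a) (x *+ 2 ^ n *~ b)).
  move=> e e0.
  (* The factor [w^2] turns the weight [w^n], given for [2^(n+1)], into the weight [w^(n+2)]
     required at index [n + 1]. *)
  have [N I] := H (x *~ a) (x *~ b) _ (mulr_gt0 e0 (exprn_gt0 2 w0)).
  exists N.+1 => -[//|n] /I; rewrite -mulrA -exprD add2n.
  by rewrite !(mulrzAC (2 ^ n.+1)%N _ x : _ *+ _ = _).
have H2 (m a b : int) : negligible_wrt (fun n => w ^+ n.+1)
    (fun n => v m%:~R * phi (x *+ 2 ^ n *~ a) (x *+ 2 ^ n *~ b)).
  by apply: negligible_wrt_le (H1 a b) => n; rewrite ler_piMl ?nav_int_le1.
apply: negligible_wrt_max; first exact: (H2 _ 1 1).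
apply: negligible_wrt_max; first exact: (H2 _ 2 1).
apply: negligible_wrt_max; first exact: (H1 1 2).
apply: negligible_wrt_max; first exact: (H1 _ 1).
apply: negligible_wrt_max; first exact: (H1 _ 1).
apply: negligible_wrt_max; first exact: (H1 1 1).
apply: negligible_wrt_max; first exact: (H2 _ 2 2).
apply: negligible_wrt_max; first exact: (H2 _ 1 2).
apply: negligible_wrt_max; first exact: (H1 1 3).
apply: negligible_wrt_max; first exact: (H1 _ 1).
exact: (H1 _ 1).
Qed.

Lemma dbl_diff_limit (b d : nat) : complete_wrt nrm -> odd_fun f ->
  (forall x y, nrm (Dop k f x y) <= phi x y) ->
  b%:R != 0 :> K -> (d + b = 10)%N -> (d * b = 16)%N ->
  (forall x y, negligible_wrt (fun n => v b%:R ^+ n)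
     (fun n => Num.max (phi (x *+ (2 ^ n.+1)) (y *+ (2 ^ n.+1)))
                       (v d%:R * phi (x *+ (2 ^ n)) (y *+ (2 ^ n))))) ->
  exists L : G -> X,
  [/\ forall x, nrm_cvg nrm (fun n => (b%:R ^+ n)^-1 *: dbl_diff d f (x *+ 2 ^ n)) (L x),
      odd_fun L, forall x y, Dop k L x y = 0 & forall x, L (x *+ 2) = L x *+ b].
Proof.
move=> cpl oddf fphi b0 db10 db16 H.
apply: (scaled_limit vP nrmP) => //; first exact: odd_dbl_diff.
  move=> x; apply: negligible_wrt_le (_ : forall n, _ <= c^-1 * P (x *+ 2 ^ n)) _.
    by move=> n; rewrite dbl_diff_step // nrm_quadrupling.
  apply: negligible_wrtZ; first by rewrite invr_gt0.
  apply: Phi_negligible => [|y z]; first exact: nav_gt0 vP _ b0.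
  by apply: negligible_wrt_le (H y z) => n; rewrite le_max lexx.
move=> x y; apply: negligible_wrt_le (H x y) => n.
have [_ _ _ nD] := nrmP; rewrite Dop_dbl_diff; apply: le_trans (nD _ _) _.
rewrite (nrmN vP nrmP) (nrmMn nrmP) -!mulrnA -!expnSr.
by rewrite ge_max !le_max fphi /= ler_wpM2l ?orbT // nav_ge0.
Qed.

Let S x := limn (fun n : nat => maxPhi v k phi 8 x 1 n).

Section LimMaxPhi.
Hypothesis cvgS : forall x, cvgn (fun n : nat => maxPhi v k phi 8 x 1 n).

(** With the next lemma, this identifies [S x] as the supremum of these terms; [j] is [i - 1] for
    the index [i] of [maxPhi]. *)
Lemma le_lim_maxPhi x j : P (x *+ 2 ^ j) / v 8%:R ^+ j.+1 <= S x.
Proof.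
(* The range [1 <= i < n] contains [j + 1] from [n = j + 2] on. *)
apply: limr_ge => //; exists j.+2 => // n /= jn; rewrite /maxPhi.
apply: (@bigmax_sup_seq _ _ _ _ _ j.+1) => //; first by rewrite mem_index_iota.
by rewrite natrX navX.
Qed.

Lemma lim_maxPhi_le x B : 0 <= B ->
  (forall j, P (x *+ 2 ^ j) / v 8%:R ^+ j.+1 <= B) -> S x <= B.
Proof.
move=> B0 H; apply: limr_le => //; exists 0%N => // n _; rewrite /maxPhi.
rewrite big_seq; apply: bigmax_le => // -[|j]; rewrite mem_index_iota //= => _.
by rewrite natrX navX.
Qed.

Lemma lim_maxPhi_ge0 x : 0 <= S x.
Proof.
apply: le_trans (le_lim_maxPhi x 0).
by rewrite divr_ge0 ?Phi_ge0 ?exprn_ge0 ?nav_ge0.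
Qed.

(** Since [|8| <= |2|], each term of the maximum for 2 is at most the one for 8, so the cubic part
    dominates. *)
Lemma bound_le x : cvgn (fun n : nat => maxPhi v k phi 2 x 1 n) ->
  c^-1 * Num.max (limn (fun n : nat => maxPhi v k phi 2 x 1 n) / v 2%:R) (S x / v 8%:R)
  <= (c * v 8%:R)^-1 * S x.
Proof.
move=> cvA; rewrite invfM -mulrA ler_pM2l ?invr_gt0 // [_^-1 * _]mulrC.
rewrite ge_max lexx andbT; apply: ler_pM.
- apply: limr_ge => //; exists 0%N => // n _; exact: bigmax_ge_id.
- by rewrite invr_ge0 ltW.
- apply: limr_le => //; exists 0%N => // n _; rewrite /maxPhi.
  rewrite big_seq; apply: bigmax_le; first exact: lim_maxPhi_ge0.
  move=> -[|j]; rewrite mem_index_iota //= => _.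
  apply: le_trans (le_lim_maxPhi x j); rewrite natrX navX //.
  by rewrite ler_wpM2l ?Phi_ge0 // lef_pV2 ?posrE ?exprn_gt0 // lerXn2r ?nnegrE ?nav_ge0.
- by rewrite lef_pV2.
Qed.

(** Up to the factor [|8|^n], [S (2^n x)] is the supremum of the tail from [n] on of the terms
    defining [S x]. *)
Lemma lim_maxPhi_negligible :
  (forall x y, negligible_wrt (fun n => v 8%:R ^+ n)
     (fun n => phi (x *+ (2 ^ n.+1)) (y *+ (2 ^ n.+1)))) ->
  forall x e, 0 < e -> exists i, forall n, (i <= n)%N -> S (x *+ 2 ^ n) <= e * v 8%:R ^+ n.
Proof.
move=> H x e e0; have [N I] := Phi_negligible v8_gt0 H x e0.
exists N => n Nn; apply: lim_maxPhi_le => [|j].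
  by rewrite mulr_ge0 ?exprn_ge0 // ltW.
rewrite ler_pdivrMr ?exprn_gt0 // -mulrnA -expnD -mulrA -exprD addnS ltW // I //.
exact: leq_trans Nn (leq_addr _ _).
Qed.

End LimMaxPhi.

(** Both series advance together: their increments are multiples of the same [E], and the combined
    coefficient has valuation at most [1 / (|2| |8|^(n+1))]. *)
Lemma nrm_partial_remainder x B n : 0 <= B ->
  (forall j, nrm (f (x *+ 2 ^ j *+ 4) - f (x *+ 2 ^ j *+ 2) *+ 10 + f (x *+ 2 ^ j) *+ 16)
     <= v 2%:R * v 8%:R ^+ j.+1 * B) ->
  nrm (f x + 6%:R^-1 *: ((2%:R ^+ n)^-1 *: dbl_diff 8 f (x *+ 2 ^ n))
           - 6%:R^-1 *: ((8%:R ^+ n)^-1 *: dbl_diff 2 f (x *+ 2 ^ n))) <= B.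
Proof.
move=> B0 H; elim: n => [|n IHn].
  (* At [n = 0] the remainder is [f + (g - h) / 6 = 0]. *)
  rewrite !expr0 invr1 !scale1r mulr1n -addrA -scalerBr /dbl_diff.
  have -> : f (x *+ 2) - f x *+ 8 - (f (x *+ 2) - f x *+ 2) = - (f x *+ 6) by zmod.
  by rewrite -scaler_nat scalerN scalerA mulVf // scale1r subrr (nrm0 nrmP).
set y := x *+ 2 ^ n in H IHn *.
have yE : x *+ 2 ^ n.+1 = y *+ 2 by rewrite expnSr mulrnA.
rewrite yE.
have e8 := @dbl_diff_step _ _ f 8 2 y erefl erefl; have e2 := @dbl_diff_step _ _ f 2 8 y erefl erefl.
set E := f (y *+ 4) - f (y *+ 2) *+ 10 + f y *+ 16 in e8 e2.
have scale_step (b : nat) z : b%:R != 0 :> K ->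
    6%:R^-1 *: ((b%:R ^+ n.+1)^-1 *: (E + z *+ b)) =
    (6%:R^-1 * (b%:R ^+ n.+1)^-1) *: E + 6%:R^-1 *: ((b%:R ^+ n)^-1 *: z).
  by move=> b0; rewrite -scaler_nat !scalerDr !scalerA exprSr invfM -!mulrA mulVf // mulr1.
rewrite -[dbl_diff 8 f (y *+ 2)](subrK (dbl_diff 8 f y *+ 2)) e8 scale_step //.
rewrite -[dbl_diff 2 f (y *+ 2)](subrK (dbl_diff 2 f y *+ 8)) e2 scale_step //.
have [m m4] := dvdn3_exp4B1 n.+1.
(* With [4^(n+1) = 1 + 3 m], the 3 in the denominator cancels and only [m], of valuation at most 1,
   remains above. *)
have qE : 6%:R^-1 * (2%:R ^+ n.+1)^-1 - 6%:R^-1 * (8%:R ^+ n.+1)^-1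
    = m%:R * (2%:R * 8%:R ^+ n.+1)^-1 :> K.
  have : (4%:R ^+ n.+1 != 0 :> K) by rewrite (natrM _ 2 2) expf_neq0 ?mulf_neq0.
  rewrite (natrM _ 2 4) exprMn -!natrX m4 natrD natrM.
  have : (2 ^ n.+1)%:R != 0 :> K by rewrite natrX expf_neq0.
  move: ((2 ^ n.+1)%:R : K) (m%:R : K) => t s t0 s0.
  by field; rewrite t0 s0 n2 n6.
rewrite opprD [f x + (_ + _)]addrCA addrACA.
apply: (nrmD_le nrmP) => //.
rewrite -scalerBl qE (nrmZ nrmP) !(navM vP) (navV vP) ?mulf_neq0 ?expf_neq0 //.
rewrite (navM vP) (navX vP).
have w0 : 0 < v 2%:R * v 8%:R ^+ n.+1 by rewrite mulr_gt0 ?exprn_gt0.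
rewrite -mulrA; apply: le_trans (_ : 1 * B <= B); last by rewrite mul1r.
apply: ler_pM; [exact: nav_ge0 vP _ | | exact: nav_nat_le1 vP _ |].
  by rewrite mulr_ge0 ?(nrm_ge0 nrmP) // invr_ge0 ltW.
by rewrite ler_pdivrMl // H.
Qed.

Lemma additive_cubic_unique (A C A' C' : G -> X) M :
  additive_fun A -> cubic_fun C -> additive_fun A' -> cubic_fun C' ->
  (forall x e, 0 < e -> exists i, forall n, (i <= n)%N ->
     nrm (A' (x *+ 2 ^ n) - A (x *+ 2 ^ n) + (C' (x *+ 2 ^ n) - C (x *+ 2 ^ n)))
     <= M * (e * v 8%:R ^+ n)) ->
  A' = A /\ C' = C.
Proof.
move=> addA cubC addA' cubC' H.
have H1 x e : 0 < e -> exists n,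
    nrm ((A' x - A x) *+ 2 ^ n + (C' x - C x) *+ 8 ^ n) <= M * (e * v 8%:R ^+ n) /\
    nrm ((A' x - A x) *+ 2 ^ n.+1 + (C' x - C x) *+ 8 ^ n.+1)
      <= M * (e * v 8%:R ^+ n).
  move=> e0; have [n I] := H x e e0; exists n.
  have E i : A' (x *+ 2 ^ i) - A (x *+ 2 ^ i) + (C' (x *+ 2 ^ i) - C (x *+ 2 ^ i))
      = (A' x - A x) *+ 2 ^ i + (C' x - C x) *+ 8 ^ i.
    by rewrite !(additive_funMn addA, additive_funMn addA', cubic_funMn n2 cubC,
                 cubic_funMn n2 cubC') -!mulrnBl.
  have In := I n (leqnn n); split; first by rewrite -E.
  have M0 : 0 <= M.
    by rewrite -(@pmulr_lge0 _ (e * v 8%:R ^+ n)) ?mulr_gt0 ?exprn_gt0 //;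
       apply: le_trans In; apply: nrm_ge0 nrmP _.
  (* As [|8| <= 1], the bound at [n + 1] is at most the one at [n], so both estimates share it. *)
  rewrite -E; apply: le_trans (I n.+1 (leqnSn n)) _.
  rewrite ler_wpM2l // ler_wpM2l ?(ltW e0) // exprS ler_piMl ?nav_nat_le1 //.
  by rewrite exprn_ge0 ?ltW.
have eqC x : C' x - C x = 0.
  apply: (@mulrz_inj0 K _ _ 6) => //.
  apply: (nrm_small_eq0 nrmP (M := M)) => e e0; have [n [I J]] := H1 x e e0.
  have w0 : 0 < v 8%:R ^+ n by rewrite exprn_gt0.
  rewrite -(navX vP) -natrX in w0 I J.
  rewrite -(ler_pM2l w0) -(nrmMn nrmP) mulrC -mulrA.
  (* Subtracting twice the relation at [n] from the one at [n + 1] cancels the additive part. *)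
  have -> : (C' x - C x) *~ 6 *+ 8 ^ n =
     (A' x - A x) *+ 2 ^ n.+1 + (C' x - C x) *+ 8 ^ n.+1
     - ((A' x - A x) *+ 2 ^ n + (C' x - C x) *+ 8 ^ n) *+ 2.
    rewrite !expnSr !mulrnA; set a := (A' x - A x) *+ _; set b := C' x - C x.
    rewrite -[b *~ 6]/(b *+ 6) mulrnAC; zmod.
  by apply: (nrmB_le vP nrmP) => //; apply: le_trans (nrmMn_le vP nrmP _ _) _.
have eqA x : A' x - A x = 0.
  apply: (nrm_small_eq0 nrmP (M := M)) => e e0; have [n [I _]] := H1 x e e0.
  (* With the cubic part gone, [|2|^n |a| <= M e |8|^n <= M e |2|^n], and [|2|^n] cancels. *)
  rewrite eqC mul0rn addr0 (nrmMn nrmP) natrX (navX vP) in I.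
  have w0 : 0 < v 2%:R ^+ n by rewrite exprn_gt0.
  have M0 : 0 <= M * e.
    have : 0 <= M * (e * v 8%:R ^+ n).
      by apply: le_trans I; rewrite mulr_ge0 ?(nrm_ge0 nrmP) // ltW.
    by rewrite mulrA pmulr_lge0 // exprn_gt0.
  rewrite -(ler_pM2l w0) (le_trans I) // mulrA mulrC ler_wpM2r //.
  by rewrite lerXn2r ?nnegrE ?nav_ge0.
by split; apply/funext => x; apply/eqP; rewrite -subr_eq0 ?eqA ?eqC.
Qed.

End Stability.

(** * Existence and uniqueness of the decomposition *)

Theorem theorem2p4 (R : realType) (K : fieldType) (G : zmodType) (X : lmodType K)
  (v : K -> R) (nrm : X -> R) (k : int) (phi : G -> G -> R) (f : G -> X) :
  nonarch_valuation v -> nontrivial_valuation v ->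
  nonarch_norm v nrm -> complete_wrt nrm ->
  k != 0 -> k != 1 -> k != -1 ->
  (k ^+ 2 * (k ^+ 2 - 1))%:~R != 0 :> K ->
  (forall x y, 0 <= phi x y) ->
  (forall x y,
     (fun n : nat => (v (2 ^ n)%:R)^-1 *
        Num.max (phi (x *+ (2 ^ n.+1)) (y *+ (2 ^ n.+1)))
                (v 8%:R * phi (x *+ (2 ^ n)) (y *+ (2 ^ n)))) @ \oo --> 0) ->
  (forall x y,
     (fun n : nat => (v (8 ^ n)%:R)^-1 *
        Num.max (phi (x *+ (2 ^ n.+1)) (y *+ (2 ^ n.+1)))
                (v 2%:R * phi (x *+ (2 ^ n)) (y *+ (2 ^ n)))) @ \oo --> 0) ->
  (forall x, cvgn (fun n : nat => maxPhi v k phi 2 x 1 n)) ->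
  (forall x, cvgn (fun n : nat => maxPhi v k phi 8 x 1 n)) ->
  odd_fun f ->
  (forall x y, nrm (Dop k f x y) <= phi x y) ->
  let phiA := fun x => limn (fun n : nat => maxPhi v k phi 2 x 1 n) in
  let phiC := fun x => limn (fun n : nat => maxPhi v k phi 8 x 1 n) in
  let bound := fun x => (v (k ^+ 2 * (k ^+ 2 - 1))%:~R)^-1 *
                 Num.max (phiA x / v 2%:R) (phiC x / v 8%:R) in
  exists A C : G -> X,
    [/\ additive_fun A, cubic_fun C,
        (forall x, nrm (f x - A x - C x) <= bound x)
      & ((forall x,
            (forall i, cvgn (fun n : nat => maxPhi v k phi 2 x i.+1 (n + i.+1))) /\
            (fun i : nat => limn (fun n : nat => maxPhi v k phi 2 x i.+1 (n + i.+1)))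
              @ \oo --> 0) ->
         (forall x,
            (forall i, cvgn (fun n : nat => maxPhi v k phi 8 x i.+1 (n + i.+1))) /\
            (fun i : nat => limn (fun n : nat => maxPhi v k phi 8 x i.+1 (n + i.+1)))
              @ \oo --> 0) ->
         forall A' C' : G -> X, additive_fun A' -> cubic_fun C' ->
           (forall x, nrm (f x - A' x - C' x) <= bound x) ->
           A' = A /\ C' = C)].
Proof.
move=> vP _ nrmP cpl _ _ _ c0 phi0 lim2 lim8 cvA cvC oddf fphi phiA phiC bound.
have n6 := natr6_neq0 c0.
have n2 : 2%:R != 0 :> K by apply: contraNneq n6 => e; rewrite (natrM _ 2 3) e mul0r.
have n8 : 8%:R != 0 :> K by rewrite (natrX _ 2 3) expf_neq0.
have negl (b : nat) (u : nat -> R) : b%:R != 0 :> K ->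
    (fun n => (v (b ^ n)%:R)^-1 * u n) @ \oo --> 0 ->
    negligible_wrt (fun n => v b%:R ^+ n) u.
  move=> b0 cu e e0; have bX n : v (b ^ n)%:R = v b%:R ^+ n by rewrite natrX navX.
  have [|N H] := cvgn0_negligible_wrt (w := fun n => v (b ^ n)%:R) _ cu e0.
    by move=> n; rewrite bX exprn_gt0 // nav_gt0.
  by exists N => n; rewrite -bX; apply: H.
have [A1 [cvA1 oddA1 DA1 A1_2]] := dbl_diff_limit vP nrmP c0 phi0 cpl oddf fphi n2
  (erefl : (8 + 2 = 10)%N) erefl (fun x y => negl 2 _ n2 (lim2 x y)).
have [C1 [cvC1 oddC1 DC1 C1_2]] := dbl_diff_limit vP nrmP c0 phi0 cpl oddf fphi n8
  (erefl : (2 + 8 = 10)%N) erefl (fun x y => negl 8%N _ n8 (lim8 x y)).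
have addA1 := Dop0_additive c0 DA1 oddA1 A1_2.
have cubC1 := Dop0_cubic c0 DC1 oddC1 C1_2.
have addA : additive_fun (fun x => - (6%:R^-1 *: A1 x)).
  by move=> x y; rewrite addA1 scalerDr opprD.
have cubC : cubic_fun (fun x => 6%:R^-1 *: C1 x).
  by move=> x y; rewrite -scalerDr cubC1 !scalerDr.
have vc : 0 < v (k ^+ 2 * (k ^+ 2 - 1))%:~R by rewrite nav_gt0.
have v2 : 0 < v 2%:R by rewrite nav_gt0.
have v8 : 0 < v 8%:R by rewrite nav_gt0.
have S0 x : 0 <= phiC x := lim_maxPhi_ge0 vP phi0 cvC x.
have fAC x : nrm (f x - - (6%:R^-1 *: A1 x) - 6%:R^-1 *: C1 x) <= bound x.
  (* The combined series gives the sharper bound with [phiC x / |2|], which is at most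
     [phiC x / |8|]. *)
  apply: le_trans (_ : _ <= (v (k ^+ 2 * (k ^+ 2 - 1))%:~R)^-1 * (phiC x / v 2%:R)) _.
    rewrite opprK; apply: (nrm_cvg_le vP nrmP).
      apply: (nrm_cvgD nrmP _ (nrm_cvgN vP nrmP (nrm_cvgZ vP nrmP _ (cvC1 x)))).
      exact: (nrm_cvgD nrmP (nrm_cvg_const nrmP (f x)) (nrm_cvgZ vP nrmP _ (cvA1 x))).
    move=> n; apply: (nrm_partial_remainder vP nrmP c0) => [|j].
      by rewrite mulr_ge0 ?divr_ge0 ?invr_ge0 ?(ltW vc) ?(ltW v2).
    apply: le_trans (nrm_quadrupling vP nrmP c0 _ oddf fphi) _.
    rewrite mulrCA ler_pM2l ?invr_gt0 // mulrC mulrA divfK ?gt_eqF //.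
    by rewrite -ler_pdivrMr ?exprn_gt0 //; apply: le_lim_maxPhi cvC _ _.
  rewrite /bound ler_pM2l ?invr_gt0 // le_max; apply/orP; right.
  rewrite ler_wpM2l // lef_pV2 // (natrM _ 2 4) navM // ler_piMr ?nav_ge0 //.
  exact: nav_nat_le1.
exists (fun x => - (6%:R^-1 *: A1 x)), (fun x => 6%:R^-1 *: C1 x); split => //.
move=> _ _ A' C' addA' cubC' fAC'.
apply: (additive_cubic_unique vP nrmP c0 (M := (v (k ^+ 2 * (k ^+ 2 - 1))%:~R * v 8%:R)^-1))
  => // x e e0.
have [|i H] := lim_maxPhi_negligible vP c0 phi0 cvC _ x e0.
  move=> y z; apply: negligible_wrt_le (negl 8%N _ n8 (lim8 y z)) => n.
  by rewrite le_max lexx.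
exists i => n /H Hn; set y := x *+ 2 ^ n in Hn *.
(* The discrepancy between the two decompositions is the difference of their remainders, each
   bounded by [bound y]. *)
have -> : A' y - - (6%:R^-1 *: A1 y) + (C' y - 6%:R^-1 *: C1 y)
  = f y - - (6%:R^-1 *: A1 y) - 6%:R^-1 *: C1 y - (f y - A' y - C' y) by zmod.
apply: le_trans (_ : bound y <= _); first exact: (nrmB_le vP nrmP).
apply: le_trans (bound_le vP c0 phi0 cvC (cvA y)) _.
by rewrite ler_pM2l ?invr_gt0 ?mulr_gt0.
Qed.
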